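(* Let $G$ and its complement $\overline{G}$ be connected graphs of order $n\geq 24$. Then $n-5 \leq rvd(G)+rvd(\overline{G})\leq 2n$, and the upper bound is sharp, i.e. for each $n\geq 24$ there is a graph $G$ of order $n$, with $G$ and $\overline{G}$ both connected, such that $rvd(G)+rvd(\overline{G})=2n$.
   Context: All graphs are simple, finite and undirected; the order of $G$ is $n=|V(G)|$, and a graph is nontrivial if it has at least two vertices. Let $G$ be a nontrivial connected graph whose vertices are colored (adjacent vertices may receive the same color). A set $X\subseteq V(G)$ is rainbow if no two vertices of $X$ have the same color. For two distinct vertices $x,y$ of $G$: if $x,y$ are nonadjacent, an $x$-$y$ rainbow vertex-cut is a rainbow set $S\subseteq V(G)\setminus\{x,y\}$ such that $x$ and $y$ belong to different components of $G-S$; if $x,y$ are adjacent, an $x$-$y$ rainbow vertex-cut is a set $S\subseteq V(G)\setminus\{x,y\}$ such that $x$ and $y$ belong to different components of $(G-xy)-S$ and at least one of $S\cup\{x\}$, $S\cup\{y\}$ is rainbow. The coloring is a rainbow vertex-disconnection coloring if every two distinct vertices $x,y$ of $G$ have an $x$-$y$ rainbow vertex-cut. The rainbow vertex-disconnection number $rvd(G)$ is the minimum number of colors in a rainbow vertex-disconnection coloring of $G$. *)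

(* Defs.v *)
From HB Require Import structures.
From mathcomp Require Import all_boot.

Set Implicit Arguments.
Unset Strict Implicit.
Unset Printing Implicit Defensive.

Record sgraph (T : finType) := SGraph {
  adj :> rel T;
  adj_sym : symmetric adj;
  adj_irrefl : irreflexive adj }.

Definition compl_rel (T : finType) (e : rel T) : rel T :=
  fun x y => (x != y) && ~~ e x y.

Lemma compl_sym (T : finType) (G : sgraph T) : symmetric (compl_rel G).
Proof. by move=> x y; rewrite /compl_rel eq_sym adj_sym. Qed.

Lemma compl_irrefl (T : finType) (G : sgraph T) : irreflexive (compl_rel G).
Proof. by move=> x; rewrite /compl_rel eqxx. Qed.

Definition compl (T : finType) (G : sgraph T) : sgraph T :=
  SGraph (@compl_sym T G) (@compl_irrefl T G).

(* The empty graph also satisfies this. *)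
Definition connected (T : finType) (e : rel T) : Prop :=
  forall x y, connect e x y.

Definition component (T : finType) (e : rel T) (x : T) : {set T} :=
  [set y | connect e x y].

(* The deleted vertices stay in the carrier type as isolated vertices; this
   does not affect the components of the vertices outside [S]. *)
Definition del_vertices (T : finType) (e : rel T) (S : {set T}) : rel T :=
  fun u v => [&& u \notin S, v \notin S & e u v].

Definition del_edge (T : finType) (e : rel T) (x y : T) : rel T :=
  fun u v => e u v && ([set u; v] != [set x; y]).

Definition rainbow (T : finType) (C : eqType) (c : T -> C) (X : {set T}) : bool :=
  dinjectiveb c (mem X).

Definition rainbow_vertex_cut (T : finType) (C : eqType) (G : sgraph T)
    (c : T -> C) (x y : T) (S : {set T}) : bool :=
  (S \subset ~: [set x; y]) &&
  (if G x y then
     (component (del_vertices (del_edge G x y) S) x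
        != component (del_vertices (del_edge G x y) S) y)
     && (rainbow c (x |: S) || rainbow c (y |: S))
   else
     (component (del_vertices G S) x != component (del_vertices G S) y)
     && rainbow c S).

Definition rvd_coloring (T : finType) (C : eqType) (G : sgraph T) (c : T -> C) : bool :=
  [forall x, forall y, (x != y) ==>
     [exists S : {set T}, rainbow_vertex_cut G c x y S]].

Definition rvd_colorable (T : finType) (G : sgraph T) (k : nat) : bool :=
  [exists c : {ffun T -> 'I_k}, rvd_coloring G c].

(* Colouring all vertices differently works, with S = V(G) \ {x, y}. *)
Lemma rvd_colorable_order (T : finType) (G : sgraph T) :
  exists k, rvd_colorable G k.
Proof.
exists #|T|; apply/existsP; exists [ffun x => enum_rank x].
apply/forallP=> x; apply/forallP=> y; apply/implyP=> nxy.
apply/existsP; exists (~: [set x; y]); rewrite /rainbow_vertex_cut subxx /=.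
have rb X : rainbow [ffun x : T => enum_rank x] X.
  by apply/dinjectiveP=> u v _ _; rewrite !ffunE => /enum_rank_inj.
have sep (e : rel T) : ~~ e x y ->
  component (del_vertices e (~: [set x; y])) x
    != component (del_vertices e (~: [set x; y])) y.
  move=> ne; apply/eqP=> /setP/(_ y); rewrite !inE connect0.
  suff cl p : forall z, path (del_vertices e (~: [set x; y])) x p ->
      z = last x p -> z = x.
    by case/connectP=> p hp /(cl _ _ hp) yx; rewrite yx eqxx in nxy.
  elim: p => [|w p IH] z //= /andP[]; rewrite /del_vertices !inE !negbK.
  case/and3P=> _ /orP[]/eqP-> exw; first exact: IH.
  by rewrite exw in ne.
by case: ifP => [_|/negbT nG]; rewrite !rb andbT sep // /del_edge eqxx andbF.
Qed.

Definition rvd (T : finType) (G : sgraph T) : nat :=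
  ex_minn (rvd_colorable_order G).

(* Main.v *)
Require Import Defs.
From HB Require Import structures.
From mathcomp Require Import all_boot.
From mathcomp Require Import zify.

Set Implicit Arguments.
Unset Strict Implicit.
Unset Printing Implicit Defensive.

(** The argument only uses one consequence of the cuts: if [u] and [v] have two
    common neighbours [x] and [y], then every [x]-[y] cut contains both [u] and
    [v], so [u] and [v] have different colours. In other words, two vertices of
    the same colour have at most one common neighbour
    ([rvd_coloring_sparse]).

    Upper bound and sharpness. Colouring all vertices differently always works,
    so [rvd G] is at most the order ([rvd_le_order]), with equality as soon as
    every two vertices have two common neighbours ([order_le_rvd]). The Paley
    graph of order 13 and its complement both have this property, even when the
    two vertices are equal, and replacing vertices by independent sets of twins
    preserves it; this yields an example of every order [n >= 13].

    Lower bound. Let [c] and [d] be colourings of [G] and of its complement,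
    using [a] and [b] colours, and suppose [a + b <= n - 6]. Let [P] and [Q] be
    the numbers of ordered pairs of distinct vertices with equal colour under
    [c] and [d]. A neighbourhood of size [m] contains at least [2 * (m - a)] of
    the pairs counted by [P], and each such pair lies in at most one
    neighbourhood; doing the same in the complement and adding,
    [2 * n * (n - 1) <= P + Q + 2 * n * (a + b)] ([sparse_degree_sum]).
    On the other hand [P <= r * (n - a)] if all classes of [c] have size at most
    [r] ([mono_pairs_le]). The numbers contradict each other for [n >= 24] once
    the classes of one colouring have size at most 8 and those of the other at
    most 7 ([degree_count_bound]).

    The bounds on the classes come from the interplay of the colourings. Given
    three vertices, any other vertex is adjacent to two of them or nonadjacent
    to two of them; hence three vertices of the same [c]-colour leave at most 6
    vertices in a class of [d] ([card_triple_cover]), and a class of [c] meets a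
    class of [d] in at most two vertices. So a class of [c] with five elements
    forces all classes of [d] to have size at most 6 ([card_class_le6]), and in
    general this bounds the classes of [d] by 8 if
    [c] has a class with three elements. Otherwise [c] has at least 7 disjoint
    classes of size two, since [b >= 1] forces [a <= n - 7]. Each of these pairs
    has between its two ends, in the complement, at least [q - 3] edges to a
    class of [d] of size [q], and by convexity this produces too many common
    neighbours inside that class if [q >= 9] ([card_class_le8_matching]). *)

(** * Colourings in which like-coloured vertices have few common neighbours *)

(** The common neighbours of [u] and [v]; for [u = v], the neighbours of [u]. *)
Definition common (T : finType) (e : rel T) (u v : T) : {set T} :=
  [set x | e u x & e v x].

(** Two distinct vertices of the same colour have at most one common
    neighbour. *)
Definition sparse_coloring (T : finType) (C : eqType) (e : rel T) (c : T -> C) :=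
  forall u v, u != v -> c u = c v -> #|common e u v| <= 1.

Definition color_class (T : finType) (C : eqType) (c : T -> C) (i : C) : {set T} :=
  [set v | c v == i].

Lemma two_step_in_cut (T : finType) (e : rel T) (S : {set T}) (x u y : T) :
  symmetric e -> x \notin S -> y \notin S -> e x u -> e y u ->
  component (del_vertices e S) x != component (del_vertices e S) y -> u \in S.
Proof.
move=> es xS yS exu eyu; apply: contraNT => uS.
have ds : connect_sym (del_vertices e S).
  by apply: sym_connect_sym => a b; rewrite /del_vertices es andbCA.
have xu : connect (del_vertices e S) x u.
  by apply: connect1; rewrite /del_vertices xS uS.
have yu : connect (del_vertices e S) y u.
  by apply: connect1; rewrite /del_vertices yS uS.
apply/eqP/setP=> z; rewrite !inE (same_connect ds xu).
by rewrite (same_connect ds yu).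
Qed.

Lemma del_edge_sym (T : finType) (e : rel T) (x y : T) :
  symmetric e -> symmetric (del_edge e x y).
Proof. by move=> es a b; rewrite /del_edge es setUC. Qed.

Lemma common_in_cut (T : finType) (C : eqType) (G : sgraph T) (c : T -> C)
    (x y u : T) (S : {set T}) :
  rainbow_vertex_cut G c x y S -> G x u -> G y u -> u \in S.
Proof.
case/andP=> /subsetP sS cut xu yu.
have xS : x \notin S by apply/negP=> /sS; rewrite !inE eqxx.
have yS : y \notin S by apply/negP=> /sS; rewrite !inE eqxx orbT.
have nux : u != x by apply: contraTneq xu => ->; rewrite adj_irrefl.
have nuy : u != y by apply: contraTneq yu => ->; rewrite adj_irrefl.
have nset w : [set w; u] != [set x; y].
  apply/eqP=> /setP/(_ u).
  by rewrite !inE eqxx orbT (negbTE nux) (negbTE nuy).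
move: cut; case: ifP => _ /andP[sep _]; apply: two_step_in_cut sep => //.
- exact/del_edge_sym/adj_sym.
- by rewrite /del_edge xu nset.
- by rewrite /del_edge yu nset.
- exact: adj_sym.
Qed.

Lemma cut_rainbow (T : finType) (C : eqType) (G : sgraph T) (c : T -> C)
    (x y : T) (S : {set T}) :
  rainbow_vertex_cut G c x y S -> {in S &, injective c}.
Proof.
have sub z : rainbow c (z |: S) -> {in S &, injective c}.
  by move/dinjectiveP=> inj u v uS vS; apply: inj; rewrite !inE ?uS ?vS orbT.
case/andP=> _; case: ifP => _ /andP[_]; first by case/orP; apply: sub.
by move/dinjectiveP.
Qed.

Lemma rvd_coloring_sparse (T : finType) (C : eqType) (G : sgraph T) (c : T -> C) :
  rvd_coloring G c -> sparse_coloring G c.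
Proof.
move=> /forallP col u v nuv cuv; rewrite leqNgt; apply/card_gt1P=> -[x [y]].
rewrite !inE => -[/andP[ux vx] /andP[uy vy] nxy].
move: (col x) => /forallP/(_ y)/implyP/(_ nxy)/existsP[S cut].
have inS w : G w x -> G w y -> w \in S.
  by move=> wx wy; apply: (common_in_cut cut); rewrite adj_sym.
case/eqP: nuv; apply: (cut_rainbow cut) => //; exact: inS.
Qed.

(** * Elementary bounds on the rainbow vertex-disconnection number *)

Lemma rvdP (T : finType) (G : sgraph T) :
  exists c : T -> 'I_(rvd G), rvd_coloring G c.
Proof. by rewrite /rvd; case: ex_minnP => m /existsP[c hc] _; exists c. Qed.

Lemma rvd_le_order (T : finType) (G : sgraph T) : rvd G <= #|T|.
Proof.
rewrite /rvd; case: ex_minnP => m _; apply.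
apply/existsP; exists [ffun x => enum_rank x].
apply/forallP=> x; apply/forallP=> y; apply/implyP=> nxy.
apply/existsP; exists (~: [set x; y]); rewrite /rainbow_vertex_cut subxx /=.
have rb X : rainbow [ffun x : T => enum_rank x] X.
  by apply/dinjectiveP=> u v _ _; rewrite !ffunE => /enum_rank_inj.
rewrite !rb /= !andbT.
suff sep (e : rel T) : irreflexive e -> ~~ e x y -> ~~ e y x ->
  component (del_vertices e (~: [set x; y])) x
    != component (del_vertices e (~: [set x; y])) y.
  case: ifP => [_|/negbT nG]; apply: sep; rewrite ?(adj_sym _ y) //.
  - by move=> z; rewrite /del_edge adj_irrefl.
  - by rewrite /del_edge eqxx andbF.
  - by rewrite /del_edge (setUC [set y]) eqxx andbF.
  - exact: adj_irrefl.
move=> ei exy eyx; apply/eqP=> /setP/(_ y); rewrite !inE connect0.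
have cl : closed (del_vertices e (~: [set x; y])) (pred1 x).
  move=> u v; rewrite /del_vertices !inE !negbK.
  case/and3P=> /orP[]/eqP-> /orP[]/eqP->; rewrite ?ei ?eqxx //.
    by rewrite (negbTE exy).
  by rewrite (negbTE eyx).
by move/(closed_connect cl); rewrite !inE eqxx eq_sym (negbTE nxy).
Qed.

(** The case [u = v] of the hypothesis says that all degrees are at least 2. It
    follows from the other cases unless the graph has a single vertex. *)
Lemma order_le_rvd (T : finType) (G : sgraph T) :
  (forall u v, 1 < #|common G u v|) -> #|T| <= rvd G.
Proof.
move=> com; have [c /rvd_coloring_sparse sp] := rvdP G.
rewrite -[rvd G]card_ord; apply: (@leq_card _ _ c) => u v cuv.
apply/eqP; apply: contraLR (com u v) => nuv; rewrite -leqNgt; exact: sp.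
Qed.

Lemma connected_of_common (T : finType) (G : sgraph T) :
  (forall u v, 1 < #|common G u v|) -> connected G.
Proof.
move=> com u v; have /card_gt0P[w] := ltnW (com u v).
rewrite inE => /andP[uw vw]; apply: (connect_trans (connect1 uw)).
by apply: connect1; rewrite adj_sym.
Qed.

(** * Blow-ups of the Paley graph of order 13 *)

(** The nonzero quadratic residues modulo 13. *)
Definition qr13 : seq nat := [:: 1; 3; 4; 9; 10; 12].

(** The quadratic nonresidues modulo 13. *)
Definition nqr13 : seq nat := [:: 2; 5; 6; 7; 8; 11].

(** The difference [a - b] modulo 13, as a number below 13. *)
Definition diff13 (a b : nat) : nat := (a %% 13 + (13 - b %% 13)) %% 13.

(** Statements about residues modulo 13 are decided by running through all
    cases. *)
Lemma all_mod13 (P : nat -> nat -> bool) :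
  all (fun a => all (P a) (iota 0 13)) (iota 0 13) ->
  forall a b, P (a %% 13) (b %% 13).
Proof.
by move=> /allP h a b; apply: (allP (h _ _)); rewrite mem_iota ltn_mod.
Qed.

(** The vertex [i] is a copy of the vertex [i %% 13] of the Paley graph; copies
    of the same vertex are not adjacent. *)
Definition paley_rel (n : nat) : rel 'I_n :=
  fun i j => diff13 i j \in qr13.

Lemma paley_sym n : symmetric (@paley_rel n).
Proof.
move=> i j; rewrite /paley_rel /diff13; apply/eqP; move: (i : nat) (j : nat).
by apply: (all_mod13 (P := fun a b =>
  ((a + (13 - b)) %% 13 \in qr13) == ((b + (13 - a)) %% 13 \in qr13))).
Qed.

Lemma paley_irrefl n : irreflexive (@paley_rel n).
Proof.
by move=> i; rewrite /paley_rel /diff13 subnKC ?modnn // ltnW // ltn_mod.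
Qed.

Definition paley (n : nat) : sgraph 'I_n := SGraph (@paley_sym n) (@paley_irrefl n).

Lemma compl_paleyE n (i j : 'I_n) : diff13 i j \in nqr13 -> compl (paley n) i j.
Proof.
move=> h; apply/andP; split.
  by apply: contraTneq h => ->; rewrite /diff13 subnKC ?modnn // ltnW // ltn_mod.
by move: h; rewrite /= /paley_rel !inE; case: eqP => [-> //|_]; do 5![case: eqP => [-> //|_]].
Qed.

(** If any two residues, possibly equal, have two common neighbours in the Cayley
    graph with connection set [D], then so do any two vertices of the blow-up: the
    residues themselves are among the vertices. *)
Lemma common_diff13 n (e : rel 'I_n) (D : seq nat) :
  13 <= n -> (forall i j : 'I_n, diff13 i j \in D -> e i j) ->
  all (fun a => all (fun b =>
    1 < count (fun x => (diff13 a x \in D) && (diff13 b x \in D)) (iota 0 13))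
    (iota 0 13)) (iota 0 13) ->
  forall u v : 'I_n, 1 < #|common e u v|.
Proof.
move=> n13 De all2 u v.
have dm (a b : nat) : diff13 (a %% 13) b = diff13 a b by rewrite /diff13 modn_mod.
have := all_mod13 all2 u v; rewrite -size_filter.
set s := filter _ _ => s2.
have us : uniq s by rewrite filter_uniq ?iota_uniq.
have inT (k : nat) (hk : k < size s) : exists2 x : 'I_n, val x = nth 0 s k & x \in common e u v.
  have := mem_nth 0 hk; rewrite mem_filter mem_iota !dm => /andP[/andP[ux vx]] /= x13.
  exists (Ordinal (leq_trans x13 n13)) => //.
  by rewrite inE !De.
have [x xE xu] := inT 0 (ltnW s2); have [y yE yu] := inT 1 s2.
apply/card_gt1P; exists x, y; split=> //.
by apply/eqP=> /(congr1 val)/eqP; rewrite /= xE yE nth_uniq // ltnW.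
Qed.

Lemma paley_common n : 13 <= n -> forall u v, 1 < #|common (paley n) u v|.
Proof. by move=> n13; apply: (common_diff13 (D := qr13) n13) => //; vm_compute. Qed.

Lemma compl_paley_common n :
  13 <= n -> forall u v, 1 < #|common (compl (paley n)) u v|.
Proof. by move=> n13; apply: (common_diff13 n13 (@compl_paleyE n)); vm_compute. Qed.

(** * Counting pairs in neighbourhoods *)

(** The number of ordered pairs of elements of [A] that are related by [r]; the
    summands [r u v] are booleans read as 0 or 1. *)
Definition pair_count (T : finType) (r : rel T) (A : {set T}) : nat :=
  \sum_(u in A) \sum_(v in A) r u v.

(** Each pair is counted once for each common neighbour of its ends. *)
Lemma pair_count_nbhd (T : finType) (e r : rel T) :
  (forall u v, r u v -> #|common e u v| <= 1) ->
  \sum_x pair_count r [set u | e u x] <= pair_count r setT.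
Proof.
move=> h; rewrite /pair_count.
have E x : \sum_(u in [set u | e u x]) \sum_(v in [set v | e v x]) r u v =
    \sum_u \sum_v r u v * (e u x && e v x).
  rewrite big_mkcond; apply: eq_bigr => u _; rewrite inE; case: (e u x) => /=.
    rewrite big_mkcond; apply: eq_bigr => v _; rewrite inE.
    by case: (e v x); rewrite ?muln1 ?muln0.
  by rewrite big1 // => v _; rewrite muln0.
rewrite (eq_bigr _ (fun x _ => E x)) exchange_big /=.
rewrite big_mkcond [X in _ <= X]big_mkcond /=; apply: leq_sum => u _.
rewrite inE exchange_big /= [X in _ <= X]big_mkcond; apply: leq_sum => v _.
rewrite inE -big_distrr /=; case: (boolP (r u v)) => [/h|_]; last by rewrite mul0n.
rewrite mul1n; apply: leq_trans; rewrite -sum1_card big_mkcond /=.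
by rewrite [X in _ <= X]big_mkcond; apply: leq_sum => x _; rewrite inE; case: andP.
Qed.

(** Counting ordered pairs of distinct elements of [Y] in all neighbourhoods. *)
Lemma sum_nbhd_in (T : finType) (e : rel T) (Y : {set T}) :
  {in Y &, forall u v, u != v -> #|common e u v| <= 1} ->
  \sum_x #|Y :&: [set u | e u x]| * #|Y :&: [set u | e u x]|.-1 <= #|Y| * #|Y|.-1.
Proof.
move=> h; pose r u v := [&& u \in Y, v \in Y & u != v].
have E A : pair_count r A = #|Y :&: A| * #|Y :&: A|.-1.
  rewrite /pair_count big_mkcond -sum_nat_const [RHS]big_mkcond /=.
  apply: eq_bigr => u _; rewrite inE andbC; case: ifP => //= uA.
  case: ifP => uY; last by rewrite big1 // => v _; rewrite /r uY.
  rewrite (cardsD1 u) !inE uY uA /= -sum1_card big_mkcond [RHS]big_mkcond.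
  apply: eq_bigr => v _; rewrite !inE /r uY /= eq_sym.
  by case: (v \in A); case: (v \in Y); case: (v == u).
under eq_bigr => x _ do rewrite -E.
rewrite -[in X in _ <= X](setIT Y) -E; apply: pair_count_nbhd => u v.
by case/and3P=> uY vY; apply: h.
Qed.

Definition mono_pair (T : finType) (C : eqType) (c : T -> C) : rel T :=
  fun u v => (u != v) && (c u == c v).

(** Sums over colours range over [c @: T], the set of colours that occur. *)
Lemma card_color_sum (T C : finType) (c : T -> C) (A : {set T}) :
  #|A| = \sum_(i in c @: T) #|A :&: color_class c i|.
Proof.
rewrite -sum1_card (partition_big c (mem (c @: T))) /=; last first.
  by move=> u _; apply: imset_f.
apply: eq_bigr => i _; rewrite -sum1_card; apply: eq_bigl => u.
by rewrite !inE.
Qed.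

Lemma mono_pairs_sum (T C : finType) (c : T -> C) (A : {set T}) :
  pair_count (mono_pair c) A =
  \sum_(i in c @: T) #|A :&: color_class c i| * #|A :&: color_class c i|.-1.
Proof.
rewrite /pair_count (partition_big c (mem (c @: T))) /=; last first.
  by move=> u _; apply: imset_f.
apply: eq_bigr => i _; rewrite -sum_nat_const.
apply: eq_big => [u|u /andP[uA /eqP cu]]; first by rewrite !inE.
rewrite (cardsD1 u) !inE uA cu eqxx /= -sum1_card big_mkcond [RHS]big_mkcond.
apply: eq_bigr => v _; rewrite !inE /mono_pair [v == u]eq_sym cu [i == _]eq_sym.
by case: (v \in A); case: (u == v); case: (c v == i).
Qed.

(** A class with [m] elements in [A] contributes [m * (m - 1) >= 2 * m - 2]. *)
Lemma mono_pairs_ge (T C : finType) (c : T -> C) (A : {set T}) :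
  2 * #|A| <= pair_count (mono_pair c) A + 2 * #|c @: T|.
Proof.
rewrite mono_pairs_sum (card_color_sum c) big_distrr /= [2 * #|c @: _|]mulnC.
rewrite -sum_nat_const -big_split /=; apply: leq_sum => i _; nia.
Qed.

(** A class of size [m] with [1 <= m <= r] contributes
    [m * (m - 1) <= r * (m - 1)]; only nonempty classes satisfy this, which is
    why unused colours must not be counted. *)
Lemma mono_pairs_le (T C : finType) (c : T -> C) r :
  (forall i, #|color_class c i| <= r) ->
  pair_count (mono_pair c) setT + r * #|c @: T| <= r * #|T|.
Proof.
move=> hr; rewrite mono_pairs_sum -[#|T|]cardsT (card_color_sum c setT).
rewrite big_distrr /= [r * #|_|]mulnC -sum_nat_const -big_split /=.
apply: leq_sum => i; rewrite setTI => /imsetP[u _ iu]; have := hr i.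
have: 0 < #|color_class c i| by apply/card_gt0P; exists u; rewrite inE iu.
nia.
Qed.

Lemma sparse_degree_sum (T C : finType) (e : rel T) (c : T -> C) :
  sparse_coloring e c ->
  2 * \sum_x #|[set u | e u x]| <=
    pair_count (mono_pair c) setT + #|T| * (2 * #|c @: T|).
Proof.
move=> sp; rewrite big_distrr /=.
apply: (@leq_trans (\sum_x (pair_count (mono_pair c) [set u | e u x] + 2 * #|c @: T|))).
  by apply: leq_sum => x _; apply: mono_pairs_ge.
rewrite big_split /= sum_nat_const leq_add2r; apply: pair_count_nbhd => u v.
by case/andP=> nuv /eqP; apply: sp.
Qed.

(** * Colour classes of two complementary sparse colourings *)

(** Any vertex outside the triple [Z] is joined by [e], or by [f], to two of its
    elements. There are three pairs in [Z] and two relations, and for each of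
    these six choices at most one vertex of [W] qualifies. *)
Lemma card_triple_cover (T : finType) (e f : rel T) (Z W : {set T}) :
  (forall x y, x != y -> e x y || f x y) -> #|Z| = 3 ->
  {in Z &, forall u v, u != v -> #|W :&: common e u v| <= 1} ->
  {in Z &, forall u v, u != v -> #|W :&: common f u v| <= 1} ->
  #|W :\: Z| <= 6.
Proof.
move=> cov Z3 he hf.
have [u [v [w [uZ vZ wZ [nuv nvw nwu] ZE]]]] : exists u v w,
  [/\ u \in Z, v \in Z, w \in Z, [/\ u != v, v != w & w != u]
     & Z \subset [set u; v; w]].
  have /card_gt2P[u [v [w [[uZ vZ wZ] [nuv nvw nwu]]]]] : 2 < #|Z| by rewrite Z3.
  exists u, v, w; split=> //.
  suff /eqP<- : [set u; v; w] == Z by [].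
  rewrite eqEcard Z3 !subUset !sub1set uZ vZ wZ /=.
  by rewrite -setUA !cardsU1 cards1 !inE (negbTE nuv) (negbTE nvw) [u == w]eq_sym (negbTE nwu).
pose U (g : rel T) := (W :&: common g u v) :|: (W :&: common g v w) :|: (W :&: common g w u).
have U3 g : {in Z &, forall x y, x != y -> #|W :&: common g x y| <= 1} -> #|U g| <= 3.
  move=> h; have := h u v uZ vZ nuv; have := h v w vZ wZ nvw; have := h w u wZ uZ nwu.
  rewrite /U; move: (W :&: _) (W :&: _) (W :&: _) => A B D hA hB hD.
  by have := (leq_card_setU (A :|: B) D).1; have := (leq_card_setU A B).1; lia.
have sub : W :\: Z \subset U e :|: U f.
  apply/subsetP=> x; rewrite !inE => /andP[xZ xW]; rewrite xW /=.
  have ne z : z \in Z -> e z x || f z x.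
    by move=> zZ; apply: cov; apply: contraNneq xZ => <-.
  move: (ne u uZ) (ne v vZ) (ne w wZ).
  by do 3![case: (e _ x) => /=] => //; do 3![case: (f _ x) => //=].
apply: leq_trans (subset_leq_card sub) _.
by have := U3 e he; have := U3 f hf; have := (leq_card_setU (U e) (U f)).1; lia.
Qed.

Lemma common_sub_le (T : finType) (e : rel T) (W : {set T}) (u v : T) :
  #|common e u v| <= 1 -> #|W :&: common e u v| <= 1.
Proof. by apply: leq_trans; apply/subset_leq_card/subsetIr. Qed.

(** A bound on common neighbours of vertices of [Y] turns into a bound on common
    neighbours inside [Y]: both exclude a cycle of length four. *)
Lemma common_flip (T : finType) (f : rel T) (Y : {set T}) :
  symmetric f ->
  {in Y &, forall u v, u != v -> #|common f u v| <= 1} ->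
  forall u v, u != v -> #|Y :&: common f u v| <= 1.
Proof.
move=> fs h u v nuv; rewrite leqNgt; apply/card_gt1P=> -[x [y]].
rewrite !inE => -[/and3P[xY ux vx] /and3P[yY uy vy] nxy].
have := h x y xY yY nxy; rewrite leqNgt => /negP; apply.
by apply/card_gt1P; exists u, v; rewrite !inE ![f _ u]fs ![f _ v]fs ux uy vx vy.
Qed.

(** The function [z * (z - 1)] is convex. *)
Lemma pair_convexity (a b : nat) :
  (a + b) * (a + b - 2) <= 2 * (a * a.-1 + b * b.-1).
Proof.
wlog ab : a b / a <= b => [hw|].
  by have [/hw//|/ltnW/hw] := leqP a b; rewrite addnC [X in 2 * X]addnC.
case: a ab => [|a] ab.
  by rewrite !add0n mulnCA leq_mul2l; lia.
case: b ab => // b; rewrite ltnS => /subnKC<-; move: (b - a) => k.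
rewrite (_ : _ - 2 = a + (a + k)); last by lia.
by rewrite /=; nia.
Qed.

(** The relations [e] and [f] stand for a graph and its complement; only that
    together they join every two distinct vertices is needed. *)
Section TwoColorings.
Variables (T C D : finType) (e f : rel T) (c : T -> C) (d : T -> D).
Hypotheses (es : symmetric e) (fs : symmetric f).
Hypothesis cov : forall x y, x != y -> e x y || f x y.
Hypotheses (ce : sparse_coloring e c) (df : sparse_coloring f d).
Hypothesis T10 : 10 <= #|T|.

Lemma class_sparse (j : D) :
  {in color_class d j &, forall u v, u != v -> #|common f u v| <= 1}.
Proof. by move=> u v; rewrite !inE => /eqP du /eqP dv /df; apply; rewrite du. Qed.

Lemma card_class_inter (i : C) (j : D) :
  #|color_class c i :&: color_class d j| <= 2.
Proof.
rewrite leqNgt; apply/negP=> /card_geqP[s [us s3 sI]].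
pose Z := [set x in s].
have Z3 : #|Z| = 3 by rewrite cardsE (card_uniqP us).
have ZI z : z \in Z -> c z = i /\ d z = j.
  by rewrite inE => /sI; rewrite !inE => /andP[/eqP-> /eqP->].
have : #|setT :\: Z| <= 6.
  apply: (card_triple_cover cov Z3) => u v /ZI[cu du] /ZI[cv dv] nuv.
    by apply/common_sub_le/ce => //; rewrite cu.
  by apply/common_sub_le/df => //; rewrite du.
by rewrite setTD cardsCs setCK Z3; lia.
Qed.

Lemma card_class_triple (i : C) (j : D) (Z : {set T}) :
  Z \subset color_class c i -> #|Z| = 3 -> #|color_class d j :\: Z| <= 6.
Proof.
move=> /subsetP Zi Z3; apply: (card_triple_cover cov Z3) => u v uZ vZ nuv.
  apply/common_sub_le/ce => //.
  by move: (Zi _ uZ) (Zi _ vZ); rewrite !inE => /eqP-> /eqP->.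
exact/(common_flip fs (@class_sparse j)).
Qed.

Lemma exists_triple (A : {set T}) : 2 < #|A| -> exists2 Z : {set T}, Z \subset A & #|Z| = 3.
Proof.
move=> /card_geqP[s [us s3 sA]]; exists [set x in s].
  by apply/subsetP=> x; rewrite inE => /sA.
by rewrite cardsE (card_uniqP us).
Qed.

Lemma card_class_le8_triple (i : C) (j : D) :
  2 < #|color_class c i| -> #|color_class d j| <= 8.
Proof.
move=> /exists_triple[Z Zi Z3]; have := card_class_triple j Zi Z3.
have := card_class_inter i j; rewrite -(cardsID Z (color_class d j)).
have : #|color_class d j :&: Z| <= #|color_class c i :&: color_class d j|.
  by rewrite setIC; apply/subset_leq_card/setSI.
lia.
Qed.

(** A class of [c] with five elements has three outside the given class of [d]. *)
Lemma card_class_le6 (i : C) (j : D) :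
  4 < #|color_class c i| -> #|color_class d j| <= 6.
Proof.
move=> i4; have := card_class_inter i j.
have := cardsID (color_class d j) (color_class c i) => ID I2.
have [|Z ZD Z3] := @exists_triple (color_class c i :\: color_class d j); first by lia.
have := card_class_triple j (subset_trans ZD (subsetDl _ _)) Z3.
suff /setDidPl-> : [disjoint color_class d j & Z] by [].
rewrite disjoint_sym; move: ZD; rewrite subsetD => /andP[] //.
Qed.

(** The case in which the classes of [c] have size one or two. By the hypothesis
    on the number of colours at least seven of them have size two. *)
Lemma card_class_le8_matching (j : D) :
  (forall i, #|color_class c i| <= 2) -> #|c @: T| + 7 <= #|T| ->
  #|color_class d j| <= 8.
Proof.
move=> c2 excess; have := @class_sparse j; move: (color_class d j) => Y Ysp.
set q := #|Y|; rewrite leqNgt; apply/negP=> q9.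
(* [g u] is the number of [f]-neighbours of [u] in the class [Y] of size [q]. *)
pose g u := #|Y :&: [set y | f y u]|; pose h u := g u * (g u).-1.
have hsum : \sum_u h u <= q * q.-1 by apply: sum_nbhd_in.
(* All elements of [Y] are [f]-neighbours of [u] or of [v], except for [u], [v]
   and possibly one common [e]-neighbour. *)
have gpair u v : mono_pair c u v -> q <= g u + g v + 3.
  case/andP=> nuv /eqP cuv; rewrite /q /g.
  have sub : Y \subset (Y :&: [set y | f y u]) :|: (Y :&: [set y | f y v])
                :|: (common e u v :|: [set u; v]).
    apply/subsetP=> y yY; rewrite !inE yY /=.
    have [->|nyu] := eqVneq y u; first by rewrite !orbT.
    have [->|nyv] := eqVneq y v; first by rewrite !orbT.
    move: (cov nyu) (cov nyv); rewrite ![e y _]es.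
    by case: (f y u); case: (f y v) => //=; rewrite !orbF => -> ->.
  apply: leq_trans (subset_leq_card sub) _.
  have := (leq_card_setU ((Y :&: [set y | f y u]) :|: (Y :&: [set y | f y v]))
    (common e u v :|: [set u; v])).1.
  have := (leq_card_setU (Y :&: [set y | f y u]) (Y :&: [set y | f y v])).1.
  have := (leq_card_setU (common e u v) [set u; v]).1.
  by have := ce nuv cuv; rewrite cards2 nuv; lia.
have hpair u v : mono_pair c u v -> (q - 3) * (q - 5) <= 2 * (h u + h v).
  move=> /gpair ab; apply: leq_trans (pair_convexity _ _).
  by apply: leq_mul; lia.
(* The monochromatic pairs form a matching, so summing [h] over their ends counts
   every vertex at most once. *)
have deg1 u : \sum_v mono_pair c u v <= 1.
  have := c2 (c u); rewrite (cardsD1 u) inE eqxx add1n ltnS; apply: leq_trans.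
  rewrite -sum1_card [X in _ <= X]big_mkcond; apply: leq_sum => v _.
  by rewrite !inE /mono_pair eq_sym [c u == _]eq_sym; case: andP.
have msym u v : mono_pair c u v = mono_pair c v u.
  by rewrite /mono_pair eq_sym [c u == _]eq_sym.
have one : \sum_u \sum_v mono_pair c u v * h u <= \sum_u h u.
  apply: leq_sum => u _; rewrite -big_distrl /= -[X in _ <= X]mul1n leq_mul2r.
  by rewrite deg1 orbT.
have two : \sum_u \sum_v mono_pair c u v * h v <= \sum_u h u.
  rewrite exchange_big /=; apply: leq_trans one; apply/eq_leq/eq_bigr => u _.
  by apply: eq_bigr => v _; rewrite msym.
have tot : pair_count (mono_pair c) setT * ((q - 3) * (q - 5)) <=
    2 * (\sum_u \sum_v mono_pair c u v * h u + \sum_u \sum_v mono_pair c u v * h v).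
  rewrite -big_split /= big_distrr big_distrl /= big_mkcond.
  apply: leq_sum => u _; rewrite inE -big_split /= big_distrr big_distrl /= big_mkcond.
  apply: leq_sum => v _; rewrite inE -mulnDr.
  by case: (boolP (mono_pair c u v)) => [/hpair|_]; rewrite ?mul0n ?mul1n.
have := mono_pairs_ge c setT; rewrite cardsT => M.
have {}M : 14 <= pair_count (mono_pair c) setT by lia.
have : 14 * ((q - 3) * (q - 5)) <= 4 * (q * q.-1).
  by apply: leq_trans (leq_trans (leq_mul M (leqnn _)) tot) _; lia.
move: q9 => /subnKC<-; move: (q - 9) => k.
have -> : (9 + k).-1 = 8 + k by lia.
have -> : 9 + k - 3 = 6 + k by lia.
have -> : 9 + k - 5 = 4 + k by lia.
by clear; nia.
Qed.

Lemma card_class_le8 (j : D) :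
  #|c @: T| + 7 <= #|T| -> #|color_class d j| <= 8.
Proof.
move=> excess; have [/existsP[i i3]|] := boolP [exists i, 2 < #|color_class c i|].
  exact: card_class_le8_triple i3.
rewrite negb_exists => /forallP c2; apply: card_class_le8_matching => // i.
by rewrite leqNgt c2.
Qed.

End TwoColorings.

(** Here [a] and [b] are numbers of colours, [P] and [Q] numbers of ordered
    monochromatic pairs, [S1] and [S2] degree sums, and [t] is the order. With 8
    in place of 7 in the bound on [Q] the hypotheses would admit [t = 24] and
    [a + b = 18]. *)
Lemma degree_count_bound (t a b P Q S1 S2 : nat) :
  0 < a -> Q + 7 * b <= 7 * t -> P + 8 * a <= 8 * t -> t * t.-1 <= S1 + S2 ->
  2 * S1 <= P + t * (2 * a) -> 2 * S2 <= Q + t * (2 * b) -> 24 <= t ->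
  t <= a + b + 5.
Proof.
move=> a0 hQ hP deg s1 s2 t24; rewrite leqNgt; apply/negP=> small.
(* The difference [t - (a + b + 6)] is the deficit below the claimed bound. *)
have tE : t.-1 = a + b + 5 + (t - (a + b + 6)) by lia.
have : 24 * (t - (a + b + 6)) <= t * (t - (a + b + 6)) by rewrite leq_mul2r t24 orbT.
move: deg; rewrite tE !mulnDr => deg ts.
rewrite ![t * (2 * _)]mulnCA in s1 s2.
by move: (t * a) (t * b) (t * (_ - _)) deg ts s1 s2 => ta tb tt; lia.
Qed.

(** The lower bound, for the numbers of colours that are actually used. *)
Lemma sparse_colors_sum (T C D : finType) (e f : rel T) (c : T -> C) (d : T -> D) :
  symmetric e -> symmetric f -> (forall x y, x != y -> e x y || f x y) ->
  sparse_coloring e c -> sparse_coloring f d -> 24 <= #|T| ->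
  #|T| <= #|c @: T| + #|d @: T| + 5.
Proof.
move=> es fs cov ce df T24; rewrite leqNgt; apply/negP=> small.
have T10 : 10 <= #|T| by lia.
have [x0 _] : exists x0 : T, x0 \in T by apply/card_gt0P/(leq_trans _ T24).
have c0 : 0 < #|c @: T| by apply/card_gt0P; exists (c x0); apply: imset_f.
have d0 : 0 < #|d @: T| by apply/card_gt0P; exists (d x0); apply: imset_f.
have vof x y : x != y -> f x y || e x y by rewrite orbC; apply: cov.
(* As each colouring uses a colour, the other one uses at most [#|T| - 7]. *)
have d8 j : #|color_class d j| <= 8.
  by apply: (card_class_le8 es fs cov ce df T10); lia.
have c8 i : #|color_class c i| <= 8.
  by apply: (card_class_le8 fs es vof df ce T10); lia.
have Pc := mono_pairs_le c8; have Pd := mono_pairs_le d8.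
have deg : #|T| * #|T|.-1 <= \sum_x #|[set u | e u x]| + \sum_x #|[set u | f u x]|.
  rewrite -sum_nat_const -big_split; apply: leq_sum => x _ /=.
  apply: leq_trans (leq_card_setU _ _).1.
  rewrite -(cardsC1 x); apply/subset_leq_card/subsetP=> u.
  by rewrite !inE => /cov.
have sc := sparse_degree_sum ce; have sd := sparse_degree_sum df.
have [/existsP[i i8]|] := boolP [exists i, 7 < #|color_class c i|].
  have d7 j : #|color_class d j| <= 7.
    by have := card_class_le6 fs cov ce df T10 j (ltnW (ltnW (ltnW i8))); lia.
  by have := degree_count_bound c0 (mono_pairs_le d7) Pc deg sc sd T24; lia.
rewrite negb_exists => /forallP c7'.
have c7 i : #|color_class c i| <= 7 by rewrite leqNgt c7'.
rewrite addnC in deg.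
by have := degree_count_bound d0 (mono_pairs_le c7) Pd deg sd sc T24; lia.
Qed.

Theorem theorem6p11 (n : nat) (hn : 24 <= n) :
  (forall (T : finType) (G : sgraph T),
      #|T| = n -> connected G -> connected (compl G) ->
      n - 5 <= rvd G + rvd (compl G) <= 2 * n)
  /\ (exists (T : finType) (G : sgraph T),
      [/\ #|T| = n, connected G, connected (compl G)
        & rvd G + rvd (compl G) = 2 * n]).
Proof.
split=> [T G Tn _ _|].
  apply/andP; split; last first.
    by rewrite mul2n -addnn -Tn leq_add ?rvd_le_order.
  have [c /rvd_coloring_sparse cG] := rvdP G.
  have [d /rvd_coloring_sparse dG] := rvdP (compl G).
  have cov x y : x != y -> G x y || compl G x y.
    by rewrite /= /compl_rel => ->; case: (G x y).
  have ca : #|c @: T| <= rvd G by rewrite -[leqRHS]card_ord max_card.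
  have da : #|d @: T| <= rvd (compl G) by rewrite -[leqRHS]card_ord max_card.
  rewrite leq_subLR addnC -Tn; apply: leq_trans (leq_add (leq_add ca da) (leqnn 5)).
  apply: sparse_colors_sum cov cG dG _; rewrite ?Tn //; exact: adj_sym.
have n13 : 13 <= n by lia.
have pc := paley_common n13; have cpc := compl_paley_common n13.
exists 'I_n, (paley n); split.
- exact: card_ord.
- exact: connected_of_common.
- exact: connected_of_common.
- have rvd_n (H : sgraph 'I_n) : (forall u v, 1 < #|common H u v|) -> rvd H = n.
    move=> com; apply/eqP; rewrite eqn_leq -[n in _ <= n]card_ord rvd_le_order.
    by rewrite -[n in n <= _]card_ord order_le_rvd.
  by rewrite !rvd_n // mul2n addnn.
Qed.
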